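(* Let $\alpha\in(0,1)$, $\theta_1,\ldots,\theta_{M_1}\in\Theta_1$, and let $\Phi^\ast$ and $\Delta^\ast_{M_1}$ be as defined below. Suppose that for every $\bar\Omega^\ast=(\omega_1^\ast,\ldots,\omega^\ast_{M_1})\in\Delta_{M_1}^\ast$ a least favorable distribution $\Lambda_{\bar\Omega^\ast}$ over $\Theta_0$ (for the alternative density $g_{\bar\Omega^\ast}=\sum_j\omega_j^\ast f_{\theta_j}$) exists and that the set \[ \Big\{y\in\mathcal Y:\ \sum_{j=1}^{M_1}\omega_j^\ast f_{\theta_j}(y)=\mathrm{cv}_{\bar\Omega^\ast}\int f_\theta(y)\,d\Lambda_{\bar\Omega^\ast}(\theta)\Big\} \] has $\nu$-measure zero. Then for every $\bar\Omega^\ast\in\Delta^\ast_{M_1}$, the Neyman–Pearson test $\varphi_{\Lambda_{\bar\Omega^\ast},\bar\Omega^\ast}$ is the $\nu$-a.e. unique maximizer over $\varphi\in\Phi_\alpha$ of $\sum_{j=1}^{M_1}\omega_j^\ast\int(\varphi-\varphi_{ah})f_{\theta_j}\,d\nu$. Furthermore, for any $\varphi_1^\ast,\varphi_2^\ast\in\Phi^\ast$ and any $\bar\Omega_1^\ast,\bar\Omega_2^\ast\in\Delta^\ast_{M_1}$, \[ \varphi_1^\ast=\varphi_2^\ast=\varphi_{\Lambda_{\bar\Omega_1^\ast},\bar\Omega_1^\ast}=\varphi_{\Lambda_{\bar\Omega_2^\ast},\bar\Omega_2^\ast}\quad\nu\text{-a.e.} \]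
   Context: A random element $Y$ takes values in a metric space $\mathcal Y$ (with its Borel $\sigma$-algebra) and has density $f_\theta$ with respect to a $\sigma$-finite measure $\nu$, where $\theta\in\Theta\subset\mathbb R^k$; $(\theta,y)\mapsto f_\theta(y)$ is assumed jointly measurable. $\Theta_0,\Theta_1\subset\Theta$ are disjoint Borel sets. A test is a measurable $\varphi:\mathcal Y\to[0,1]$; $\Phi$ is the set of all tests and $\Phi_\alpha=\{\varphi\in\Phi:\sup_{\theta\in\Theta_0}\int\varphi f_\theta\,d\nu\le\alpha\}$. $\varphi_{ah}\in\Phi_\alpha$ is a fixed given test. $\Delta_{M_1}$ is the unit simplex in $\mathbb R^{M_1}$. Define $\Phi^\ast=\arg\max_{\varphi\in\Phi_\alpha}\min_{j=1,\ldots,M_1}\int(\varphi-\varphi_{ah})f_{\theta_j}\,d\nu$ and $\Delta^\ast_{M_1}=\arg\min_{\bar\Omega\in\Delta_{M_1}}\sup_{\varphi\in\Phi_\alpha}\sum_{j}\omega_j\int(\varphi-\varphi_{ah})f_{\theta_j}\,d\nu$. For an alternative density $g$ and a probability distribution $\Lambda$ on $\Theta_0$, write $h_\Lambda=\int f_\theta\,d\Lambda(\theta)$ and let $\beta_\Lambda=\sup\{\int\varphi g\,d\nu:\varphi\in\Phi,\ \int\varphi h_\Lambda\,d\nu\le\alpha\}$. $\Lambda$ is a least favorable distribution (for $g$) if $\beta_\Lambda\le\beta_{\Lambda'}$ for every probability distribution $\Lambda'$ on $\Theta_0$. For $g=g_{\bar\Omega}=\sum_j\omega_jf_{\theta_j}$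 and such $\Lambda$, the Neyman–Pearson test $\varphi_{\Lambda,\bar\Omega}$ equals $1$ where $g>\mathrm{cv}_{\bar\Omega}h_\Lambda$, equals $\varkappa_{\bar\Omega}$ where $g=\mathrm{cv}_{\bar\Omega}h_\Lambda$, and $0$ where $g<\mathrm{cv}_{\bar\Omega}h_\Lambda$, with constants $\mathrm{cv}_{\bar\Omega}\ge0$, $\varkappa_{\bar\Omega}\in[0,1]$ chosen so that $\int\varphi_{\Lambda,\bar\Omega}h_\Lambda\,d\nu=\alpha$. *)

(* Defs.v *)
From HB Require Import structures.
From mathcomp Require Import all_boot all_order all_algebra.
From mathcomp Require Import all_classical all_reals all_analysis.
Set Implicit Arguments. Unset Strict Implicit. Unset Printing Implicit Defensive.
Import Order.TTheory GRing.Theory Num.Theory.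
Import numFieldNormedType.Exports.
Local Open Scope classical_set_scope.
Local Open Scope ring_scope.

Notation borelT T := (g_sigma_algebraType (@open T%type)).

Notation paramT R k := (borelT 'rV[R]_k).

Section Defs.
Context {R : realType}.
Context {dY dP : measure_display} {Y : measurableType dY} {P : measurableType dP}.
Variable nu : {measure set Y -> \bar R}.

Local Open Scope ereal_scope.

(* Joint measurability of (theta, y) |-> f theta y on Theta x Y, where Theta
   carries the trace sigma-algebra (Theta need not itself be measurable). *)
Definition jointly_measurable_on (Theta : set P) (f : P -> Y -> R) : Prop :=
  forall B : set R, measurable B ->
    exists A : set (P * Y)%type, measurable A /\
      (Theta `*` setT) `&` [set p | B (f p.1 p.2)] = (Theta `*` setT) `&` A.

Definition is_test (phi : Y -> R) : Prop :=
  measurable_fun setT phi /\ forall y, (0 <= phi y <= 1)%R.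

Definition power (phi : Y -> R) (g : Y -> R) : \bar R :=
  \int[nu]_y (phi y * g y)%:E.

Definition Phi_alpha (f : P -> Y -> R) (Theta0 : set P) (alpha : R) : set (Y -> R) :=
  [set phi | is_test phi /\ forall th, Theta0 th -> power phi (f th) <= alpha%:E].

Variable M : nat.

Definition simplex : set ('I_M -> R) :=
  [set w | (forall j, 0 <= w j)%R /\ (\sum_(j < M) w j = 1)%R].

Definition objmin (f : P -> Y -> R) (th : 'I_M -> P) (phiah phi : Y -> R) : \bar R :=
  \big[mine/+oo]_(j < M) (power phi (f (th j)) - power phiah (f (th j))).

Definition objW (f : P -> Y -> R) (th : 'I_M -> P) (phiah : Y -> R)
  (w : 'I_M -> R) (phi : Y -> R) : \bar R :=
  \sum_(j < M) ((w j)%:E * (power phi (f (th j)) - power phiah (f (th j)))).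

Definition Phi_star (f : P -> Y -> R) (Theta0 : set P) (alpha : R)
  (th : 'I_M -> P) (phiah : Y -> R) : set (Y -> R) :=
  [set phi | Phi_alpha f Theta0 alpha phi /\
     forall psi, Phi_alpha f Theta0 alpha psi ->
       objmin f th phiah psi <= objmin f th phiah phi].

Definition Vsup (f : P -> Y -> R) (Theta0 : set P) (alpha : R)
  (th : 'I_M -> P) (phiah : Y -> R) (w : 'I_M -> R) : \bar R :=
  ereal_sup [set objW f th phiah w phi | phi in Phi_alpha f Theta0 alpha].

Definition Delta_star (f : P -> Y -> R) (Theta0 : set P) (alpha : R)
  (th : 'I_M -> P) (phiah : Y -> R) : set ('I_M -> R) :=
  [set w | simplex w /\ forall w', simplex w' ->
     Vsup f Theta0 alpha th phiah w <= Vsup f Theta0 alpha th phiah w'].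

Definition gmix (f : P -> Y -> R) (th : 'I_M -> P) (w : 'I_M -> R) (y : Y) : R :=
  (\sum_(j < M) w j * f (th j) y)%R.

(* h_Lambda(y) = int f_theta(y) dLambda(theta), Lambda concentrated on Theta0 *)
Definition hmix (f : P -> Y -> R) (Theta0 : set P) (Lam : probability P R) (y : Y) : \bar R :=
  \int[Lam]_(th in Theta0) (f th y)%:E.

Definition beta (f : P -> Y -> R) (Theta0 : set P) (alpha : R) (g : Y -> R)
  (Lam : probability P R) : \bar R :=
  ereal_sup [set \int[nu]_y (phi y * g y)%:E | phi in
     [set phi | is_test phi /\
        \int[nu]_y ((phi y)%:E * hmix f Theta0 Lam y) <= alpha%:E]].

(* probability distributions on Theta0 : probability measures on the parameter
   space giving full mass to Theta0 *)
Definition least_favorable (f : P -> Y -> R) (Theta0 : set P) (alpha : R) (g : Y -> R)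
  (Lam : probability P R) : Prop :=
  Lam Theta0 = 1 /\
  forall Lam' : probability P R, Lam' Theta0 = 1 ->
    beta f Theta0 alpha g Lam <= beta f Theta0 alpha g Lam'.

Definition NPtest (f : P -> Y -> R) (Theta0 : set P) (th : 'I_M -> P) (w : 'I_M -> R)
  (Lam : probability P R) (cv kap : R) (y : Y) : R :=
  if (cv%:E * hmix f Theta0 Lam y < (gmix f th w y)%:E) then 1%R
  else if ((gmix f th w y)%:E == cv%:E * hmix f Theta0 Lam y) then kap
  else 0%R.

End Defs.

(* Main.v *)
Require Import Defs.
From HB Require Import structures.
From mathcomp Require Import all_boot all_order all_algebra.
From mathcomp Require Import all_classical all_reals all_analysis.
From mathcomp Require Import measurable_realfun.
From mathcomp Require Import ring lra.
Import Order.TTheory GRing.Theory Num.Theory.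
Import numFieldNormedType.Exports.
Local Open Scope classical_set_scope.
Local Open Scope ring_scope.

(* Write [u = g - cv h] for the weighted alternative [g] and the least favorable
   mixture [h], and let [phi = 1_{u > 0}] be the Neyman-Pearson test.  As [u] does
   not vanish almost everywhere, [\int |phi - psi| |u| = \int (phi - psi) u]
   controls [\int (phi - psi) q] for every integrable [q], uniformly in the test
   [psi]: the difference is at most [N \int (phi - psi) u + eps].  This estimate
   replaces compactness twice.
   - Level: moving a mass [t] of the least favorable distribution to [th] in
     [Theta0] cannot decrease [beta]; comparing [phi] with nearly optimal tests of
     the perturbed problem gives [\int phi f_th <= alpha].
   - Minimax: moving a mass [t] of the minimizing weight [w] to the vertex [j]
     cannot decrease the value [V w], which gives [V w <= \int (phi - phiah) f_j].
     Hence [phi] is maximin, with value [V w], and every maximin test maximizes the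
     [w]-weighted objective, whose maximizer is almost everywhere unique. *)

(** * Integrals against tests and the separation estimate *)

Section TestIntegrals.
Set Implicit Arguments. Unset Strict Implicit.
Context {R : realType} {d : measure_display} {Y : measurableType d}.
Variable nu : {measure set Y -> \bar R}.

Local Notation integ q := (nu.-integrable setT (EFin \o q)).

Lemma integrable_measurable (q : Y -> R) : integ q -> measurable_fun setT q.
Proof. by move=> /integrableP[/measurable_EFinP]. Qed.

Lemma integrable_dominated (q1 q2 : Y -> R) : measurable_fun setT q1 ->
  (forall y, `|q1 y| <= `|q2 y|) -> integ q2 -> integ q1.
Proof.
move=> mq1 le12; apply: le_integrable => //; first exact/measurable_EFinP.
by move=> y _; rewrite /= lee_fin.
Qed.

Lemma integrable_test (phi q : Y -> R) : is_test phi -> integ q ->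
  integ (fun y => phi y * q y).
Proof.
move=> [mphi phi01] iq; have mq := integrable_measurable iq.
apply: integrable_dominated iq; first exact: measurable_funM.
move=> y; have /andP[p0 p1] := phi01 y.
by rewrite normrM (ger0_norm p0) ler_piMl.
Qed.

Lemma integrable_scale (c : R) (q : Y -> R) : integ q -> integ (fun y => c * q y).
Proof. by move=> iq; apply: (integrableZl measurableT c iq). Qed.

Lemma integrable_sub (q1 q2 : Y -> R) : integ q1 -> integ q2 ->
  integ (fun y => q1 y - q2 y).
Proof. by move=> i1 i2; apply: (integrableB measurableT i1 i2). Qed.

Lemma integrable_add (q1 q2 : Y -> R) : integ q1 -> integ q2 ->
  integ (fun y => q1 y + q2 y).
Proof. by move=> i1 i2; apply: (integrableD measurableT i1 i2). Qed.

Lemma powerE (phi q : Y -> R) : is_test phi -> integ q ->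
  power nu phi q = (\int[nu]_y (phi y * q y))%:E.
Proof.
by move=> tphi iq; rewrite /power fineK// integrable_fin_num// integrable_test.
Qed.

Lemma test_integralD (psi q1 q2 : Y -> R) (a b : R) : is_test psi ->
  integ q1 -> integ q2 ->
  \int[nu]_y (psi y * (a * q1 y + b * q2 y)) =
  a * \int[nu]_y (psi y * q1 y) + b * \int[nu]_y (psi y * q2 y).
Proof.
move=> tpsi i1 i2; rewrite -!RintegralZl//; [|exact: integrable_test..].
rewrite -RintegralD//; [|by apply: integrable_scale; exact: integrable_test..].
by apply: eq_Rintegral => y _; ring.
Qed.

Lemma integrable_lincomb (I : Type) (s : seq I) (w : I -> R) (q : I -> Y -> R) :
  (forall i, integ (q i)) -> integ (fun y => \sum_(i <- s) w i * q i y).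
Proof.
move=> iq; elim: s => [|i s IH].
  by under eq_fun do rewrite big_nil; exact: integrable0.
under eq_fun do rewrite big_cons.
by apply: integrable_add => //; exact: integrable_scale.
Qed.

Lemma test_integral_sum (I : Type) (s : seq I) (w : I -> R) (q : I -> Y -> R)
    (psi : Y -> R) : is_test psi -> (forall i, integ (q i)) ->
  \int[nu]_y (psi y * \sum_(i <- s) w i * q i y) =
  \sum_(i <- s) w i * \int[nu]_y (psi y * q i y).
Proof.
move=> tpsi iq; elim: s => [|i s IH].
  under eq_Rintegral do rewrite big_nil mulr0.
  by rewrite big_nil Rintegral_cst// mul0r.
under eq_Rintegral do rewrite big_cons -[X in _ + X]mul1r.
by rewrite test_integralD// ?mul1r ?IH ?big_cons//; exact: integrable_lincomb.
Qed.

Lemma ae_eq_Rintegral (q1 q2 : Y -> R) : measurable_fun setT q1 ->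
  measurable_fun setT q2 -> {ae nu, forall y, q1 y = q2 y} ->
  \int[nu]_y q1 y = \int[nu]_y q2 y.
Proof.
move=> m1 m2 e12; congr fine; apply: ae_eq_integral => //.
- exact/measurable_EFinP.
- exact/measurable_EFinP.
- by apply: filterS e12 => y + _ => ->.
Qed.

(** Dominated convergence: at a point with [u y != 0] the integrand vanishes once [N] exceeds
    [|q y| / |u y|], and [|q|] dominates it throughout. *)
Lemma tail_integral_small (u q : Y -> R) (eps : R) : measurable_fun setT u ->
  {ae nu, forall y, u y != 0} -> integ q -> 0 < eps ->
  exists2 N : R, 0 < N &
    \int[nu]_y (if N * `|u y| <= `|q y| then `|q y| else 0) <= eps.
Proof.
move=> mu u0 iq e0.
pose t (n : nat) (y : Y) : R := if n%:R * `|u y| <= `|q y| then `|q y| else 0.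
have mq := integrable_measurable iq.
have mt n : measurable_fun setT (t n).
  apply: measurable_fun_ifT => //; last exact: measurableT_comp.
  apply: measurable_fun_ler; last exact: measurableT_comp.
  by apply: measurable_funM => //; exact: measurableT_comp.
have t0 n y : 0 <= t n y by rewrite /t; case: ifP.
have tq n y : `|t n y| <= `|q y|.
  by rewrite ger0_norm// /t; case: ifP.
have cvt : {ae nu, forall y, setT y -> (EFin \o t n) y @[n --> \oo] --> cst 0%E y}.
  apply: filterS u0 => y uy _.
  apply: cvg_near_cst; near=> n; rewrite /= /t.
  suff /negbTE -> : ~~ (n%:R * `|u y| <= `|q y|) by [].
  rewrite -ltNge -ltr_pdivrMr ?normr_gt0//.
  by near: n; exact: nbhs_infty_gtr.
have dom : {ae nu, forall y n, setT y ->
    (`|(EFin \o t n) y| <= (`|q y|)%R%:E)%E}.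
  by apply: aeW => y n _; rewrite /= lee_fin.
have mte n : measurable_fun setT (EFin \o t n) by exact/measurable_EFinP.
have [_ _] := dominated_convergence measurableT mte (measurable_cst _) cvt
  (integrable_norm iq) dom.
rewrite integral0 => /fine_cvgP[_] /cvgr0_norm_le /(_ _ e0) [n0 _ Hn].
(* The successor keeps [N] positive even when [n0 = 0]. *)
exists n0.+1%:R => //; apply: le_trans (Hn n0.+1 (leqnSn _)).
exact: ler_norm.
Unshelve. all: by end_near. Qed.

(** The condition [u y != 0] is part of the predicate, so that the sign of [u] determines [phi]
    almost everywhere. *)
Definition separating (phi u : Y -> R) :=
  {ae nu, forall y, u y != 0 /\ phi y = if 0 < u y then 1 else 0}.

(** Where [u > 0], [phi = 1 >= psi]; where [u < 0], [phi = 0 <= psi]. Hence [(phi - psi) u] is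
    almost everywhere its own absolute value. *)
Lemma test_gapE (phi psi u : Y -> R) : is_test phi -> is_test psi -> integ u ->
  separating phi u ->
  \int[nu]_y (phi y * u y) - \int[nu]_y (psi y * u y) =
  \int[nu]_y (`|phi y - psi y| * `|u y|).
Proof.
move=> tphi tpsi iu sep; have mu := integrable_measurable iu.
rewrite -RintegralB//; [|exact: integrable_test..].
apply: ae_eq_Rintegral.
- by apply: measurable_funB; apply: measurable_funM => //; [case: tphi|case: tpsi].
- apply: measurable_funM; apply: measurableT_comp => //.
  by apply: measurable_funB; [case: tphi|case: tpsi].
- apply: filterS sep => y [u0 ->]; have /andP[p0 p1] := tpsi.2 y.
  rewrite -mulrBl -normrM; case: (ltgtP (u y) 0) u0 => // u0 _ /=.
  + by rewrite ger0_norm//; nra.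
  + by rewrite ger0_norm//; nra.
Qed.

(* Where [|q| > N |u|] the mass of [q] is small uniformly in [psi], and
   elsewhere [|q|] is dominated by [N |u|]. *)
Lemma separating_stable (phi u q : Y -> R) (eps : R) :
  is_test phi -> integ u -> separating phi u -> integ q -> 0 < eps ->
  exists2 N : R, 0 < N & forall psi, is_test psi ->
    `|\int[nu]_y (phi y * q y) - \int[nu]_y (psi y * q y)| <=
    N * (\int[nu]_y (phi y * u y) - \int[nu]_y (psi y * u y)) + eps.
Proof.
move=> tphi iu sep iq e0; have mu := integrable_measurable iu.
have mq := integrable_measurable iq.
have u0 : {ae nu, forall y, u y != 0} by apply: filterS sep => y [].
have [N N0 tail] := tail_integral_small mu u0 iq e0.
exists N => // psi tpsi; rewrite (test_gapE tphi tpsi iu sep).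
pose s y := if N * `|u y| <= `|q y| then `|q y| else 0.
have ms : measurable_fun setT s.
  apply: measurable_fun_ifT => //; last exact: measurableT_comp.
  apply: measurable_fun_ler; last exact: measurableT_comp.
  by apply: measurable_funM => //; exact: measurableT_comp.
have is_ : integ s.
  apply: integrable_dominated ms _ iq => y.
  by rewrite /s; case: ifP; rewrite ?normr_id ?normr0.
have md : measurable_fun setT (fun y => phi y - psi y).
  by apply: measurable_funB; [case: tphi|case: tpsi].
have d1 y : `|phi y - psi y| <= 1.
  have /andP[? ?] := tphi.2 y; have /andP[? ?] := tpsi.2 y.
  by rewrite ler_norml; apply/andP; split; lra.
have idu : integ (fun y => `|phi y - psi y| * `|u y|).
  apply: integrable_dominated iu => [|y].
    by apply: measurable_funM; apply: measurableT_comp.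
  by rewrite normrM !normr_id ler_piMl.
have idq : integ (fun y => (phi y - psi y) * q y).
  apply: integrable_dominated iq => [|y]; first exact: measurable_funM.
  by rewrite normrM ler_piMl.
rewrite -RintegralB//; [|exact: integrable_test..].
under eq_Rintegral do rewrite -mulrBl.
apply: le_trans (le_normr_Rintegral measurableT idq) _.
(* Since [\int s <= eps], bounding by [\int s] in place of [eps] suffices, and this reduces the
   claim to a pointwise inequality. *)
apply: le_trans (lerD (lexx _) tail).
rewrite -RintegralZl// -RintegralD//; last exact: integrable_scale.
apply: le_Rintegral => //.
- exact: integrable_norm.
- by apply: integrable_add => //; exact: integrable_scale.
- move=> y _ /=; rewrite normrM /s; case: (leP (N * `|u y|)) => [_|/ltW qu].
    by apply: ler_wpDl; [rewrite !mulr_ge0// ltW|rewrite ler_piMl].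
  by rewrite addr0 mulrCA ler_wpM2l.
Qed.

End TestIntegrals.

(** * Convex combination of a probability and a point mass *)

Section DiracMixture.
Set Implicit Arguments. Unset Strict Implicit.
Context {R : realType} {d : measure_display} {P : measurableType d}.
Variables (Lam : probability P R) (a : P) (s t : {nonneg R}).
Hypothesis st1 : s%:num + t%:num = 1.

Definition dirac_mix : set P -> \bar R :=
  measure_add (mscale s Lam) (mscale t (\d_a : {measure set P -> \bar R})).

HB.instance Definition _ := Measure.on dirac_mix.

Lemma dirac_mixE A :
  dirac_mix A = (s%:num%:E * Lam A + t%:num%:E * \d_a A)%E.
Proof. by rewrite /dirac_mix measure_addE. Qed.

Let dirac_mixT : dirac_mix setT = 1%E.
Proof. by rewrite dirac_mixE probability_setT diracT !mule1 -EFinD st1. Qed.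

HB.instance Definition _ :=
  Measure_isProbability.Build _ _ _ dirac_mix dirac_mixT.

Lemma dirac_mix_probability :
  exists Lam' : probability P R, Lam' = dirac_mix :> (set P -> \bar R).
Proof. by exists dirac_mix. Qed.

End DiracMixture.

(** * Mixtures of densities over [Theta0] and Tonelli's theorem *)

Section Mixtures.
Set Implicit Arguments. Unset Strict Implicit.
Context {R : realType} {dY dP : measure_display}.
Context {Y : measurableType dY} {P : measurableType dP}.
Variable nu : {measure set Y -> \bar R}.
Hypothesis sfnu : sigma_finite setT nu.
Variables (Theta Theta0 : set P) (f : P -> Y -> R).
Hypothesis mjoint : jointly_measurable_on Theta f.
Hypothesis f_ge0 : forall th y, Theta th -> 0 <= f th y.
Hypothesis f_dens : forall th, Theta th -> (\int[nu]_y (f th y)%:E = 1)%E.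
Hypothesis mTheta0 : measurable Theta0.
Hypothesis sTheta0 : Theta0 `<=` Theta.

(** Joint measurability gives a product-measurable [A] whose section at [th] is the preimage under
    [f th], because [th] lies in [Theta]. *)
Lemma measurable_density th : Theta th -> measurable_fun setT (f th).
Proof.
move=> Tth _ B mB; rewrite setTI; have [A [mA eA]] := mjoint mB.
have -> : f th @^-1` B = xsection A th; last exact: measurable_xsection.
apply/seteqP; split=> y; rewrite /xsection /= inE => h.
  have : ((Theta `*` setT) `&` [set p | B (f p.1 p.2)]) (th, y) by [].
  by rewrite eA => -[].
have : ((Theta `*` setT) `&` A) (th, y) by [].
by rewrite -eA => -[].
Qed.

Lemma integrable_density th : Theta th -> nu.-integrable setT (EFin \o f th).
Proof.
move=> Tth; apply/integrableP; split; first exact/measurable_EFinP/measurable_density.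
under eq_integral => y _ do rewrite /= ger0_norm ?f_ge0//.
by rewrite f_dens// ltry.
Qed.

Lemma measurable_joint0 :
  measurable_fun (Theta0 `*` setT) (fun p : P * Y => f p.1 p.2).
Proof.
move=> mD B mB; have [A [mA eA]] := mjoint mB.
have -> : Theta0 `*` setT `&` (fun p : P * Y => f p.1 p.2) @^-1` B =
          Theta0 `*` setT `&` A; last exact: measurableI.
apply/seteqP; split=> -[th y] [[/= T0 _] h]; split=> //.
  have : ((Theta `*` setT) `&` [set p | B (f p.1 p.2)]) (th, y).
    by split=> //; split=> //; exact: sTheta0.
  by rewrite eA => -[].
have : ((Theta `*` setT) `&` A) (th, y).
  by split=> //; split=> //; exact: sTheta0.
by rewrite -eA => -[].
Qed.

(** The extension by zero off [Theta0] is measurable and nonnegative on the whole product space,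
    where Tonelli's theorem applies. *)
Let f0 : P * Y -> \bar R := (fun p => (f p.1 p.2)%:E) \_ (Theta0 `*` setT).

Let mf0 : measurable_fun setT f0.
Proof.
have mD : measurable (Theta0 `*` [set: Y]) by exact: measurableX.
apply/(measurable_restrictT _ mD).
by have /measurable_EFinP := measurable_joint0.
Qed.

Let f0_ge0 p : (0 <= f0 p)%E.
Proof.
rewrite /f0 patchE; case: ifPn => // /[!inE] -[T0 _].
by rewrite lee_fin f_ge0//; exact: sTheta0.
Qed.

Let f0E th y : f0 (th, y) = ((fun th => (f th y)%:E) \_ Theta0) th.
Proof.
rewrite /f0 !patchE; congr (if _ then _ else _).
by apply/idP/idP => /[!inE] => [[]|].
Qed.

Let hmixE (Lam : probability P R) y :
  hmix f Theta0 Lam y = (\int[Lam]_th f0 (th, y))%E.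
Proof.
by rewrite /hmix integral_mkcond; apply: eq_integral => th _; rewrite f0E.
Qed.

Lemma hmix_ge0 (Lam : probability P R) y : (0 <= hmix f Theta0 Lam y)%E.
Proof. by rewrite hmixE; apply: integral_ge0. Qed.

Lemma measurable_hmix (Lam : probability P R) :
  measurable_fun setT (hmix f Theta0 Lam).
Proof.
rewrite (_ : hmix f Theta0 Lam = fun y => \int[Lam]_th f0 (th, y))%E.
  exact: measurable_fun_fubini_tonelli_G.
by apply/funext => y; exact: hmixE.
Qed.

(** A copy of [nu] that carries sigma-finiteness as a structure, as Tonelli's theorem requires. *)
Let snu : set Y -> \bar R := nu.
HB.instance Definition _ := Measure.on snu.
HB.instance Definition _ := Measure_isSigmaFinite.Build _ _ _ snu sfnu.

Let F0 (psi : Y -> R) (p : P * Y) : \bar R := ((psi p.2)%:E * f0 p)%E.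

Let mF0 psi : is_test psi -> measurable_fun setT (F0 psi).
Proof.
move=> [mpsi _]; apply: emeasurable_funM => //; apply/measurable_EFinP.
exact: (measurableT_comp mpsi).
Qed.

Let F0_ge0 psi : is_test psi -> forall p, (0 <= F0 psi p)%E.
Proof. by move=> [_ psi01] p; rewrite mule_ge0// lee_fin; case/andP: (psi01 p.2). Qed.

Let power_restr psi : is_test psi ->
  (fun th => power nu psi (f th)) \_ Theta0 = fubini_F snu (F0 psi).
Proof.
move=> tpsi; apply/funext => th; rewrite patchE /fubini_F; case: ifPn => Tth.
  by apply: eq_integral => y _; rewrite /F0 f0E patchE Tth.
by apply/esym; apply: integral0_eq => y _; rewrite /F0 f0E patchE (negbTE Tth) mule0.
Qed.

Lemma measurable_power psi : is_test psi ->
  measurable_fun Theta0 (fun th => power nu psi (f th)).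
Proof.
move=> tpsi; apply/(measurable_restrictT _ mTheta0); rewrite power_restr//.
by apply: measurable_fun_fubini_tonelli_F; [exact: mF0|exact: F0_ge0].
Qed.

(** Tonelli's theorem on the zero extension: the size under a mixture is an average of powers. *)
Lemma hmix_power (Lam : probability P R) (psi : Y -> R) : is_test psi ->
  (\int[nu]_y ((psi y)%:E * hmix f Theta0 Lam y) =
   \int[Lam]_(th in Theta0) power nu psi (f th))%E.
Proof.
move=> tpsi; have psi0 y : (0 <= (psi y)%:E)%E.
  by rewrite lee_fin; case/andP: (tpsi.2 y).
transitivity (\int[snu]_y \int[Lam]_th F0 psi (th, y))%E.
  apply: eq_integral => y _; rewrite hmixE -ge0_integralZl//.
  exact: measurableT_comp.
rewrite -fubini_tonelli//; [|exact: mF0|exact: F0_ge0].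
by rewrite [RHS]integral_mkcond power_restr.
Qed.

(** An average against a distribution of full mass on [Theta0] respects a uniform bound, so
    level-[alpha] tests have size at most [alpha] under every mixture. *)
Lemma hmix_power_le (Lam : probability P R) (psi : Y -> R) (a : R) :
  Lam Theta0 = 1%E -> is_test psi ->
  (forall th, Theta0 th -> (power nu psi (f th) <= a%:E)%E) ->
  (\int[nu]_y ((psi y)%:E * hmix f Theta0 Lam y) <= a%:E)%E.
Proof.
move=> L1 tpsi le_a; rewrite hmix_power//.
rewrite -[leRHS]mule1 -L1 -integral_cst//; apply: ge0_le_integral => //.
- move=> th Tth; apply: integral_ge0 => y _; rewrite lee_fin mulr_ge0//.
    by case/andP: (tpsi.2 y).
  by rewrite f_ge0//; exact: sTheta0.
- exact: measurable_power.
Qed.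

Lemma integral_hmix (Lam : probability P R) : Lam Theta0 = 1%E ->
  (\int[nu]_y hmix f Theta0 Lam y = 1)%E.
Proof.
move=> L1.
have t1 : is_test (cst 1 : Y -> R) by split=> // y; rewrite ler01 lexx.
have := hmix_power Lam t1; under eq_integral do rewrite mul1e.
move=> ->; rewrite -L1 -[RHS]mul1e -integral_cst//; apply: eq_integral => th /[!inE] T0.
by rewrite /power /=; under eq_integral do rewrite mul1r; rewrite f_dens//; exact: sTheta0.
Qed.

(* The value [+oo] of [hmix], taken on a null set only, is sent to [0]. *)
Definition rhmix (Lam : probability P R) y : R := fine (hmix f Theta0 Lam y).

Lemma integrable_hmix (Lam : probability P R) : Lam Theta0 = 1%E ->
  nu.-integrable setT (hmix f Theta0 Lam).
Proof.
move=> L1; apply/integrableP; split; first exact: measurable_hmix.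
under eq_integral do rewrite gee0_abs ?hmix_ge0//.
by rewrite integral_hmix// ltry.
Qed.

Lemma rhmixE (Lam : probability P R) : Lam Theta0 = 1%E ->
  {ae nu, forall y, hmix f Theta0 Lam y = (rhmix Lam y)%:E}.
Proof.
move=> L1; have := integrable_ae measurableT (integrable_hmix L1).
by apply: filterS => y /(_ I) h; rewrite /rhmix fineK.
Qed.

Lemma measurable_rhmix (Lam : probability P R) :
  measurable_fun setT (EFin \o rhmix Lam).
Proof.
apply/measurable_EFinP; exact: (measurableT_comp (fine_measurable _) (measurable_hmix Lam)).
Qed.

Lemma integrable_rhmix (Lam : probability P R) : Lam Theta0 = 1%E ->
  nu.-integrable setT (EFin \o rhmix Lam).
Proof.
move=> L1; apply: le_integrable (integrable_hmix L1) => //.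
  exact: measurable_rhmix.
move=> y _ /=; rewrite /rhmix; case: (hmix _ _ _ _) => //= ; by rewrite normr0 leey.
Qed.

Lemma hmix_Rintegral (Lam : probability P R) (psi : Y -> R) :
  Lam Theta0 = 1%E -> is_test psi ->
  (\int[nu]_y ((psi y)%:E * hmix f Theta0 Lam y))%E =
  (\int[nu]_y (psi y * rhmix Lam y))%:E.
Proof.
move=> L1 tpsi; have [mpsi _] := tpsi; have mh := measurable_rhmix Lam.
rewrite -[RHS](powerE tpsi (integrable_rhmix L1)).
apply: ae_eq_integral => //.
- by apply: emeasurable_funM (measurable_hmix Lam); exact/measurable_EFinP.
- under eq_fun do rewrite EFinM.
  by apply: emeasurable_funM mh; exact/measurable_EFinP.
- by apply: filterS (rhmixE L1) => y -> _; rewrite EFinM.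
Qed.

(** Realizes the perturbation of [Lam] towards a point of [Theta0]; the mixture density is affine in
    the mixing distribution. *)
Lemma dirac_mixture (Lam : probability P R) (a : P) (t : R) : 0 <= t <= 1 ->
  Theta0 a -> Lam Theta0 = 1%E ->
  exists Lam' : probability P R, Lam' Theta0 = 1%E /\
    forall y, hmix f Theta0 Lam' y =
      ((1 - t)%:E * hmix f Theta0 Lam y + t%:E * (f a y)%:E)%E.
Proof.
move=> /andP[t0 t1] Ta L1.
have s0 : 0 <= 1 - t by rewrite subr_ge0.
have st1 : (NngNum s0)%:num + (NngNum t0)%:num = 1 by rewrite /= subrK.
have [Lam' eL] := dirac_mix_probability Lam a st1.
exists Lam'; split.
  by rewrite eL dirac_mixE L1 diracE mem_set// !mule1 -EFinD st1.
move=> y; rewrite /hmix eL.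
have mfy : measurable_fun Theta0 (fun th => (f th y)%:E).
  apply/(measurable_restrictT _ mTheta0).
  rewrite (_ : _ \_ _ = f0 \o (fun th => (th, y))).
    by apply: (measurableT_comp mf0); exact: pair2_measurable.
  by apply/funext => th /=; rewrite f0E.
have fy0 th : Theta0 th -> (0 <= (f th y)%:E)%E.
  by move=> T0; rewrite lee_fin f_ge0//; exact: sTheta0.
rewrite ge0_integral_measure_add// !ge0_integral_mscale//=.
by rewrite integral_dirac// diracE mem_set// mul1e.
Qed.

Variables (M : nat) (thetas : 'I_M -> P) (alpha : R).
Hypothesis Tthetas : forall j, Theta (thetas j).

Lemma integrable_gmix (w : 'I_M -> R) :
  nu.-integrable setT (EFin \o gmix f thetas w).
Proof. by apply: integrable_lincomb => j; exact: integrable_density. Qed.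

Lemma test_gmix (w : 'I_M -> R) (psi : Y -> R) : is_test psi ->
  \int[nu]_y (psi y * gmix f thetas w y) =
  \sum_(j < M) w j * \int[nu]_y (psi y * f (thetas j) y).
Proof.
by move=> tpsi; apply: test_integral_sum => // j; exact: integrable_density.
Qed.

(** * The Neyman-Pearson test of a mixture: level, optimality, uniqueness *)

Section NeymanPearson.
Variables (w : 'I_M -> R) (Lam : probability P R) (cv kap : R).
Hypothesis Lam1 : Lam Theta0 = 1%E.
Hypothesis cv_ge0 : 0 <= cv.
Hypothesis kap01 : 0 <= kap <= 1.

Let phi := NPtest f Theta0 thetas w Lam cv kap.
Let g := gmix f thetas w.
Let h := rhmix Lam.
Let u y := g y - cv * h y.

Hypothesis ties : nu [set y | (g y)%:E = (cv%:E * hmix f Theta0 Lam y)%E] = 0%E.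
Hypothesis sizephi :
  (\int[nu]_y ((phi y)%:E * hmix f Theta0 Lam y) = alpha%:E)%E.

Let ig := integrable_gmix w.
Let ih := integrable_rhmix Lam1.

Let iu : nu.-integrable setT (EFin \o u).
Proof. by apply: integrable_sub => //; exact: integrable_scale. Qed.

Let mge : measurable_fun setT (EFin \o g).
Proof. by case/integrableP: ig. Qed.

Let mch : measurable_fun setT (fun y => cv%:E * hmix f Theta0 Lam y)%E.
Proof. by apply: emeasurable_funM => //; exact: measurable_hmix. Qed.

Lemma NPtest_is_test : is_test phi.
Proof.
split; last first.
  by move=> y; rewrite /phi /NPtest; do 2?case: ifP => // _; rewrite !lexx ?ler01.
apply: measurable_fun_ifT => //; first exact: measurable_fun_lte.
by apply: measurable_fun_ifT => //; exact: measurable_fun_eqe.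
Qed.

(** Almost everywhere [hmix] is finite and there is no tie, so the extended-real comparisons
    defining the test reduce to the sign of [u]. *)
Lemma NPtest_separating : separating nu phi u.
Proof.
have ntie : {ae nu, forall y, (g y)%:E <> (cv%:E * hmix f Theta0 Lam y)%E}.
  apply/negligibleP.
    rewrite setCK; have := measurable_eqe measurableT mge mch.
    by rewrite setTI.
  by rewrite setCK.
apply: filterS2 ntie (rhmixE Lam1) => y; rewrite /phi /NPtest /u -/g => + hE.
rewrite hE -EFinM => ne; have {}ne : g y != cv * h y.
  by apply/eqP => e; apply: ne; rewrite e.
by rewrite subr_eq0 ne lte_fin subr_gt0 eqe (negbTE ne).
Qed.

Let gapE psi : is_test psi ->
  \int[nu]_y (psi y * u y) =
  \int[nu]_y (psi y * g y) - cv * \int[nu]_y (psi y * h y).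
Proof.
move=> tpsi; rewrite -mulNr -[X in _ = X + _]mul1r -test_integralD//.
by apply: eq_Rintegral => y _; rewrite /u mul1r mulNr.
Qed.

Let sizeh : \int[nu]_y (phi y * h y) = alpha.
Proof.
by apply: EFin_inj; rewrite -sizephi hmix_Rintegral//; exact: NPtest_is_test.
Qed.

(* The weight [t] cancels the dependence on [psi]: with [t (1 + N cv) = 1], the
   size constraint of [psi] under [(1 - t) Lam + t \d_th] exactly offsets the
   term [N cv (alpha - \int psi h)] of the stability estimate. *)
Lemma NPtest_level : least_favorable nu f Theta0 alpha g Lam ->
  Phi_alpha nu f Theta0 alpha phi.
Proof.
move=> [_ lf]; have tphi := NPtest_is_test; split=> // th T0.
have ith := integrable_density (sTheta0 T0).
rewrite powerE// lee_fin; apply/ler_addgt0Pr => e e0.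
have e20 : 0 < e / 2 by rewrite divr_gt0.
have [N N0 stab] := separating_stable tphi iu NPtest_separating ith e20.
have D0 : 0 < 1 + N * cv by rewrite ltr_wpDr// mulr_ge0// ltW.
pose t := (1 + N * cv)^-1.
have t01 : 0 <= t <= 1.
  rewrite invr_ge0 ltW//= invf_le1// lerDl mulr_ge0//; exact: ltW.
have [Lam' [L1' hE]] := dirac_mixture t01 T0 Lam1.
(* [phi] is admissible under [Lam] and [beta] is no smaller at [Lam'], so some test admissible under
   [Lam'] loses less than [e / 2 / N] of the power of [phi]. Multiplication by [N] turns this slack
   into [e / 2]. *)
have : ((\int[nu]_y (phi y * g y) - e / 2 / N)%:E < beta nu f Theta0 alpha g Lam')%E.
  apply: lt_le_trans (lf _ L1').
  apply: (@lt_le_trans _ _ (\int[nu]_y (phi y * g y))%:E).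
    by rewrite lte_fin ltrBlDr ltrDl divr_gt0.
  apply: ereal_sup_ubound; exists phi; first by split=> //; rewrite sizephi.
  by rewrite -powerE.
move=> /ereal_sup_gt[_ [psi [tpsi size'] <-]].
rewrite hmix_Rintegral// lee_fin in size'.
rewrite -/(power nu psi g) powerE// lte_fin => near.
have {size'} size' : (1 - t) * \int[nu]_y (psi y * h y)
                     + t * \int[nu]_y (psi y * f th y) <= alpha.
  apply: le_trans size'; rewrite -test_integralD// le_eqVlt; apply/orP; left.
  have mpsi := tpsi.1; have mh := integrable_measurable ih.
  have mth := integrable_measurable ith.
  have mh' := integrable_measurable (integrable_rhmix L1').
  (* The real-valued mixture of [Lam'] splits affinely where [hmix] of [Lam] is finite, which holds
     almost everywhere. *)
  apply/eqP/ae_eq_Rintegral.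
  - by apply: measurable_funM => //; apply: measurable_funD; exact: measurable_funM.
  - exact: measurable_funM.
  - apply: filterS (rhmixE Lam1) => y hy; congr (_ * _).
    by rewrite /rhmix hE hy -!EFinM -EFinD.
move: (stab _ tpsi); rewrite !gapE// sizeh ler_norml => /andP[_ stab'].
have := ler_wpM2l (ltW D0) size'.
rewrite mulrDr !mulrA mulrBr mulr1 /t divff ?gt_eqF// mul1r => size2.
have : N * (\int[nu]_y (phi y * g y) - e / 2 / N) <= N * \int[nu]_y (psi y * g y).
  by rewrite ler_pM2l// ltW.
rewrite mulrBr [N * (e / 2 / N)]mulrC divfK ?gt_eqF// => near2.
(* Sum of the stability estimate, the size bound times [1 + N * cv] and the power bound times [N];
   what remains is [alpha + e]. *)
nra.
Qed.

Let size_le psi : Phi_alpha nu f Theta0 alpha psi ->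
  \int[nu]_y (psi y * h y) <= alpha.
Proof.
move=> [tpsi lvl]; rewrite -lee_fin -hmix_Rintegral//.
exact: hmix_power_le.
Qed.

(** Under [h] the size of [phi] is exactly [alpha] and that of [psi] at most [alpha]; as [cv >= 0],
    dropping the [cv * h] part of [u] can only enlarge the gap. *)
Lemma NPtest_gap psi : Phi_alpha nu f Theta0 alpha psi ->
  \int[nu]_y (phi y * u y) - \int[nu]_y (psi y * u y) <=
  \int[nu]_y (phi y * g y) - \int[nu]_y (psi y * g y).
Proof.
move=> fpsi; have sz := size_le fpsi; have [tpsi _] := fpsi.
have tphi := NPtest_is_test; rewrite !gapE// sizeh.
have := ler_wpM2l cv_ge0 sz; lra.
Qed.

Lemma NPtest_optimal psi : Phi_alpha nu f Theta0 alpha psi ->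
  \int[nu]_y (psi y * g y) <= \int[nu]_y (phi y * g y).
Proof.
move=> fpsi; rewrite -subr_ge0; apply: le_trans (NPtest_gap fpsi).
rewrite (test_gapE NPtest_is_test fpsi.1 iu NPtest_separating).
by apply: Rintegral_ge0 => y _; rewrite mulr_ge0.
Qed.

(** Equal power forces [\int |phi - psi| |u|] to vanish, and [u] is nonzero almost everywhere. *)
Lemma NPtest_unique psi : Phi_alpha nu f Theta0 alpha psi ->
  \int[nu]_y (psi y * g y) = \int[nu]_y (phi y * g y) ->
  {ae nu, forall y, psi y = phi y}.
Proof.
move=> fpsi eq_g; have [tpsi _] := fpsi; have tphi := NPtest_is_test.
have := NPtest_gap fpsi; rewrite eq_g subrr.
rewrite (test_gapE tphi tpsi iu NPtest_separating) => le0.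
have md : measurable_fun setT (fun y => phi y - psi y).
  by apply: measurable_funB; [case: tphi|case: tpsi].
have mu := integrable_measurable iu.
pose q y := (phi y - psi y) * u y.
have mq : measurable_fun setT q by exact: measurable_funM.
have iq : nu.-integrable setT (EFin \o q).
  apply: integrable_dominated iu => // y; rewrite /q normrM ler_piMl//.
  have /andP[? ?] := tphi.2 y; have /andP[? ?] := tpsi.2 y.
  by rewrite ler_norml; apply/andP; split; lra.
have q0 : (\int[nu]_y `|(EFin \o q) y| = 0)%E.
  have /fineK <- := integrable_fin_num measurableT (integrable_abse iq).
  congr EFin; apply/eqP; rewrite eq_le; apply/andP; split; last first.
    by apply: fine_ge0; apply: integral_ge0 => y _; exact: abse_ge0.
  apply: le_trans le0; rewrite le_eqVlt; apply/orP; left; apply/eqP.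
  by congr fine; apply: eq_integral => y _; rewrite /= /q normrM.
have mqe : measurable_fun setT (EFin \o q) by exact/measurable_EFinP.
have qae := (ae_eq_integral_abs nu measurableT mqe).1 q0.
apply: filterS2 NPtest_separating qae => y [u0 _] /(_ I) [] /eqP.
by rewrite mulf_eq0 (negbTE u0) orbF subr_eq0 => /eqP.
Qed.

End NeymanPearson.

(** * Maximin and weighted objectives *)

Variable phiah : Y -> R.
Hypothesis tphiah : is_test phiah.

Definition advantage (psi q : Y -> R) : R :=
  \int[nu]_y (psi y * q y) - \int[nu]_y (phiah y * q y).

Lemma power_diffE psi j : is_test psi ->
  (power nu psi (f (thetas j)) - power nu phiah (f (thetas j)))%E =
  (advantage psi (f (thetas j)))%:E.
Proof.
by move=> tpsi; rewrite !powerE//; apply: integrable_density.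
Qed.

Lemma objWE (w : 'I_M -> R) psi : is_test psi ->
  objW nu f thetas phiah w psi = (advantage psi (gmix f thetas w))%:E.
Proof.
move=> tpsi; rewrite /objW /advantage !test_gmix// -sumrB -sumEFin.
by apply: eq_bigr => j _; rewrite power_diffE// -EFinM mulrBr.
Qed.

(** A minimum is at most any weighted average; the averaging takes place in the reals, once the
    minimum is known to be finite. *)
Lemma objmin_le_objW (w : 'I_M -> R) psi : is_test psi -> simplex w ->
  (objmin nu f thetas phiah psi <= objW nu f thetas phiah w psi)%E.
Proof.
move=> tpsi [w0 w1].
have le_j j : (objmin nu f thetas phiah psi <= (advantage psi (f (thetas j)))%:E)%E.
  by rewrite -power_diffE// /objmin (bigD1 j)//= ge_min lexx.
have [m em] : exists m : R, objmin nu f thetas phiah psi = m%:E.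
  suff : objmin nu f thetas phiah psi \is a fin_num.
    by move=> /fineK <-; eexists.
  (* The empty minimum would be [+oo]; weights summing to [1] rule out [M = 0]. *)
  have [j0 _] : exists j : 'I_M, true.
    apply/existsP; apply: contraT; rewrite negb_exists => /forallP h.
    by move: w1; rewrite big1 => [/eqP|j _]; [rewrite eq_sym oner_eq0|have := h j].
  rewrite fin_numE; apply/andP; split; last first.
    by have := le_j j0; case: (objmin _ _ _ _ _).
  rewrite /objmin; elim/big_ind: _ => // [x y x0 y0|j _].
    by rewrite minElt; case: ifP.
  by rewrite power_diffE.
rewrite em objWE// lee_fin /advantage !test_gmix// -sumrB.
rewrite -[m]mul1r -w1 mulr_suml; apply: ler_sum => j _.
by rewrite -mulrBr ler_wpM2l// -lee_fin -em; exact: le_j.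
Qed.

(* Envelope argument: moving mass [t] from [w] to the vertex [j], with
   [t (1 + N) = 1], makes the upper bound on the payoff independent of [psi]. *)
Lemma saddle_objmin (w : 'I_M -> R) (phi u : Y -> R) :
  Delta_star nu f Theta0 alpha thetas phiah w ->
  Phi_alpha nu f Theta0 alpha phi ->
  nu.-integrable setT (EFin \o u) -> separating nu phi u ->
  (forall psi, Phi_alpha nu f Theta0 alpha psi ->
    \int[nu]_y (phi y * u y) - \int[nu]_y (psi y * u y) <=
    \int[nu]_y (phi y * gmix f thetas w y) -
    \int[nu]_y (psi y * gmix f thetas w y)) ->
  (objW nu f thetas phiah w phi <= objmin nu f thetas phiah phi)%E.
Proof.
move=> [[w0 w1] wmin] fphi iu sep gap; have [tphi _] := fphi.
have key j : advantage phi (gmix f thetas w) <= advantage phi (f (thetas j)).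
  apply/ler_addgt0Pr => e e0.
  have ij := integrable_density (Tthetas j).
  have [N N0 stab] := separating_stable tphi iu sep ij e0.
  have D0 : 0 < 1 + N by rewrite ltr_wpDr// ltW.
  pose t := (1 + N)^-1; have t0 : 0 < t by rewrite invr_gt0.
  (* The weight left on [w] is a multiple of [t], so [t] factors out of the perturbed payoff. *)
  have tN : 1 - t = t * N.
    by apply/eqP; rewrite subr_eq -{2}[t]mulr1 -mulrDr addrC mulVf// gt_eqF.
  pose w' i := (1 - t) * w i + t * (i == j)%:R.
  have sw' : simplex w'.
    split=> [i|]; first by rewrite addr_ge0// mulr_ge0// ?tN ?mulr_ge0// ltW.
    rewrite big_split/= -!mulr_sumr w1 (bigD1 j)//= eqxx big1 => [|i /negbTE ->//].
    by rewrite addr0 !mulr1 subrK.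
  have gw' psi : is_test psi -> advantage psi (gmix f thetas w') =
      (1 - t) * advantage psi (gmix f thetas w) + t * advantage psi (f (thetas j)).
    move=> tpsi.
    have e' q : is_test q -> \int[nu]_y (q y * gmix f thetas w' y) =
        (1 - t) * \int[nu]_y (q y * gmix f thetas w y) +
        t * \int[nu]_y (q y * f (thetas j) y).
      move=> tq; rewrite !test_gmix// mulr_sumr.
      have -> : t * \int[nu]_y (q y * f (thetas j) y) =
          \sum_(i < M) t * (i == j)%:R * \int[nu]_y (q y * f (thetas i) y).
        rewrite (bigD1 j)//= eqxx mulr1 big1 ?addr0// => i /negbTE ->.
        by rewrite mulr0 mul0r.
      by rewrite -big_split/=; apply: eq_bigr => i _; rewrite mulrDl mulrA.
    by rewrite /advantage !e'//; ring.
  (* The left side is at most the value at [w], hence at most the value at [w'], and the right side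
     bounds every payoff at [w']. Multiplying by [1 + N] then gives the claim up to [e]. *)
  have : ((advantage phi (gmix f thetas w))%:E <=
    (t * (advantage phi (f (thetas j)) + e + N * advantage phi (gmix f thetas w)))%:E)%E.
    apply: (@le_trans _ _ (Vsup nu f Theta0 alpha thetas phiah w)).
      by rewrite -objWE//; apply: ereal_sup_ubound; exists phi.
    apply: le_trans (wmin _ sw') _; apply: ge_ereal_sup => _ [psi fpsi <-].
    have [tpsi _] := fpsi.
    rewrite objWE// lee_fin gw'// tN -mulrA -mulrDr ler_pM2l//.
    (* The lower half of the stability estimate, with the gap in [u] replaced by the gap in the
       weighted objective, eliminates [psi]. *)
    have := ler_wpM2l (ltW N0) (gap _ fpsi).
    have := stab _ tpsi; rewrite ler_norml => /andP[+ _].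
    rewrite /advantage; lra.
  rewrite lee_fin -(ler_pM2l D0) mulrA mulfV ?gt_eqF// mul1r; lra.
rewrite objWE//; rewrite /objmin; elim/big_ind: _ => [|x y Hx Hy|j _].
- exact: leey.
- by rewrite le_min Hx.
- by rewrite power_diffE// lee_fin.
Qed.

End Mixtures.

Theorem theorem2 (R : realType) (k : nat)
  (Ymet : pseudoPMetricType R) (hY : hausdorff_space Ymet)
  (nu : {measure set (borelT Ymet) -> \bar R}) (hnu : sigma_finite setT nu)
  (Theta Theta0 Theta1 : set (paramT R k))
  (f : paramT R k -> borelT Ymet -> R)
  (hf_joint : jointly_measurable_on Theta f)
  (hf_ge0 : forall th y, Theta th -> 0 <= f th y)
  (hf_dens : forall th, Theta th -> (\int[nu]_y (f th y)%:E = 1)%E)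
  (hTheta0 : measurable Theta0) (hTheta1 : measurable Theta1)
  (hT0 : Theta0 `<=` Theta) (hT1 : Theta1 `<=` Theta)
  (hdisj : Theta0 `&` Theta1 = set0)
  (alpha : R) (halpha : 0 < alpha < 1)
  (phiah : borelT Ymet -> R) (hphiah : Phi_alpha nu f Theta0 alpha phiah)
  (M1 : nat) (hM1 : (0 < M1)%N)
  (thetas : 'I_M1 -> paramT R k) (hthetas : forall j, Theta1 (thetas j))
  (Lam : ('I_M1 -> R) -> probability (paramT R k) R)
  (cv kap : ('I_M1 -> R) -> R)
  (hLam : forall w, Delta_star nu f Theta0 alpha thetas phiah w ->
     [/\ least_favorable nu f Theta0 alpha (gmix f thetas w) (Lam w),
         0 <= cv w, 0 <= kap w <= 1,
         (\int[nu]_y ((NPtest f Theta0 thetas w (Lam w) (cv w) (kap w) y)%:E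
                        * hmix f Theta0 (Lam w) y) = alpha%:E)%E
       & nu [set y | (gmix f thetas w y)%:E = ((cv w)%:E * hmix f Theta0 (Lam w) y)%E] = 0%E]) :
  (forall w, Delta_star nu f Theta0 alpha thetas phiah w ->
     let phiNP := NPtest f Theta0 thetas w (Lam w) (cv w) (kap w) in
     [/\ Phi_alpha nu f Theta0 alpha phiNP,
         (forall psi, Phi_alpha nu f Theta0 alpha psi ->
            (objW nu f thetas phiah w psi <= objW nu f thetas phiah w phiNP)%E)
       & (forall psi, Phi_alpha nu f Theta0 alpha psi ->
            objW nu f thetas phiah w psi = objW nu f thetas phiah w phiNP ->
            {ae nu, forall y, psi y = phiNP y})])
  /\
  (forall phi1 phi2 w1 w2,
     Phi_star nu f Theta0 alpha thetas phiah phi1 ->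
     Phi_star nu f Theta0 alpha thetas phiah phi2 ->
     Delta_star nu f Theta0 alpha thetas phiah w1 ->
     Delta_star nu f Theta0 alpha thetas phiah w2 ->
     {ae nu, forall y,
        [/\ phi1 y = phi2 y,
            phi2 y = NPtest f Theta0 thetas w1 (Lam w1) (cv w1) (kap w1) y
          & NPtest f Theta0 thetas w1 (Lam w1) (cv w1) (kap w1) y
            = NPtest f Theta0 thetas w2 (Lam w2) (cv w2) (kap w2) y]}).
Proof.
have TT j : Theta (thetas j) by apply/hT1/hthetas.
have [tah _] := hphiah.
(* The fourth conjunct, a saddle inequality, is kept for the comparison with [Phi_star]. *)
have part1 w : Delta_star nu f Theta0 alpha thetas phiah w ->
  let phiNP := NPtest f Theta0 thetas w (Lam w) (cv w) (kap w) in
  [/\ Phi_alpha nu f Theta0 alpha phiNP,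
      (forall psi, Phi_alpha nu f Theta0 alpha psi ->
         (objW nu f thetas phiah w psi <= objW nu f thetas phiah w phiNP)%E),
      (forall psi, Phi_alpha nu f Theta0 alpha psi ->
         objW nu f thetas phiah w psi = objW nu f thetas phiah w phiNP ->
         {ae nu, forall y, psi y = phiNP y})
    & (objW nu f thetas phiah w phiNP <= objmin nu f thetas phiah phiNP)%E].
  move=> wD phiNP; have [lf cv0 kap01 sz ties] := hLam w wD; have [L1 _] := lf.
  have fphi : Phi_alpha nu f Theta0 alpha phiNP.
    exact: (NPtest_level hnu hf_joint hf_ge0 hf_dens hTheta0 hT0 TT L1 cv0 kap01 ties sz lf).
  have [tphi _] := fphi.
  split=> //.
  - move=> psi fpsi; have [tpsi _] := fpsi.
    rewrite !(objWE hf_joint hf_ge0 hf_dens TT tah)// lee_fin lerD2r.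
    exact: (NPtest_optimal hnu hf_joint hf_ge0 hf_dens hTheta0 hT0 TT L1 cv0 kap01 ties sz fpsi).
  - move=> psi fpsi; have [tpsi _] := fpsi.
    rewrite !(objWE hf_joint hf_ge0 hf_dens TT tah)// => -[] /addIr eg.
    exact: (NPtest_unique hnu hf_joint hf_ge0 hf_dens hTheta0 hT0 TT L1 cv0 kap01 ties sz fpsi eg).
  - have sep := NPtest_separating hnu hf_joint hf_ge0 hf_dens hTheta0 hT0 TT (kap w) L1 ties.
    apply: (saddle_objmin hf_joint hf_ge0 hf_dens TT tah wD fphi _ sep).
      apply: integrable_sub; first exact: (integrable_gmix hf_joint hf_ge0 hf_dens TT w).
      apply: integrable_scale.
      exact: (integrable_rhmix hnu hf_joint hf_ge0 hf_dens hTheta0 hT0 L1).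
    exact: (NPtest_gap hnu hf_joint hf_ge0 hf_dens hTheta0 hT0 TT L1 cv0 kap01 sz).
have star_ae phi w : Phi_star nu f Theta0 alpha thetas phiah phi ->
    Delta_star nu f Theta0 alpha thetas phiah w ->
    {ae nu, forall y, phi y = NPtest f Theta0 thetas w (Lam w) (cv w) (kap w) y}.
  move=> [fphi phimax] wD; have [fNP opt uniq saddle] := part1 w wD.
  (* The chain [objW phiNP <= objmin phiNP <= objmin phi <= objW phi] makes [phi] a maximizer of the
     weighted objective. *)
  apply: uniq => //; apply/eqP; rewrite eq_le opt//=.
  apply: le_trans saddle _; apply: le_trans (phimax _ fNP) _.
  by apply: (objmin_le_objW hf_joint hf_ge0 hf_dens TT tah); [case: fphi|case: wD].
split=> [w /part1[] //|phi1 phi2 w1 w2 s1 s2 d1 d2].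
(* The two Neyman-Pearson tests are compared through [phi1], which equals each of them almost
   everywhere. *)
apply: filterS3 (star_ae _ _ s1 d1) (star_ae _ _ s2 d1) (star_ae _ _ s1 d2).
by move=> y e11 e21 e12; split; rewrite -?e11 -?e12 ?e21.
Qed.
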